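(* Let $\mathcal{P}$ denote the set of all probability measures $P$ on $\mathbb{R}$ such that (i) $L(t)=\int_{-\infty}^{+\infty} e^{tx}\,P(dx)<\infty$ for all $t\in\mathbb{R}$, and (ii) for all $t\in\mathbb{R}$, the probability measure $P_t(dx)=\frac{e^{tx}}{L(t)}P(dx)$ satisfies $P_t((-\infty,t))\le \frac12\le P_t((-\infty,t])$. Then $\mathcal{P}=\{N(0,1)\}$; that is, a probability measure $P$ on $\mathbb{R}$ satisfies (i) and (ii) if and only if $P$ is the standard normal distribution $N(0,1)$.
   Context: $N(0,1)$ denotes the probability measure on $\mathbb{R}$ with Lebesgue density $\varphi(x)=e^{-x^2/2}/\sqrt{2\pi}$. Condition (ii) says that $t$ is a median of $P_t$ for every real $t$. *)

(* Defs.v *)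
From HB Require Import structures.
From mathcomp Require Import all_boot all_order all_algebra.
From mathcomp Require Import all_classical all_reals all_analysis.
From mathcomp Require Import measurable_realfun.

Set Implicit Arguments.
Unset Strict Implicit.
Unset Printing Implicit Defensive.
Import Order.TTheory GRing.Theory Num.Theory.
Import numFieldNormedType.Exports.
Local Open Scope classical_set_scope.
Local Open Scope ring_scope.

Definition laplace (R : realType) (P : probability (measurableTypeR R) R)
    (t : R) : \bar R :=
  (\int[P]_x (expR (t * x))%:E)%E.

(* [fine] is harmless where [laplace P t] is finite, since it is then the
   value of L(t); at [+oo] it returns 0 and [tilt] is identically zero. *)
Definition tilt (R : realType) (P : probability (measurableTypeR R) R)
    (t : R) (A : set (measurableTypeR R)) : \bar R :=
  (\int[P]_(x in A) (expR (t * x) / fine (laplace P t))%:E)%E.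

Section tilt_measure.
Context (R : realType) (P : probability (measurableTypeR R) R) (t : R).
Local Open Scope ereal_scope.

Let dens (x : measurableTypeR R) : \bar R :=
  (expR (t * x) / fine (laplace P t))%:E.

Lemma laplace_ge0 : 0 <= laplace P t.
Proof. by apply: integral_ge0 => x _; rewrite lee_fin expR_ge0. Qed.

Lemma measurable_expRM :
  measurable_fun [set: measurableTypeR R]
    ((fun x : R => (expR (t * x))%:E) : measurableTypeR R -> \bar R).
Proof.
by apply/measurable_EFinP; apply: measurableT_comp => //; exact: mulrl_measurable.
Qed.

Let dens_ge0 x : 0 <= dens x.
Proof. by rewrite lee_fin divr_ge0 ?expR_ge0// fine_ge0// laplace_ge0. Qed.

Let measurable_dens : measurable_fun setT dens.
Proof.
apply/measurable_EFinP; apply: measurable_funM => //.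
by apply/measurable_EFinP; exact: measurable_expRM.
Qed.

Let tilt0 : tilt P t set0 = 0.
Proof. exact: integral_set0. Qed.

Let tilt_ge0 A : 0 <= tilt P t A.
Proof. by apply: integral_ge0 => x _; exact: dens_ge0. Qed.

Let tilt_sigma_additive : semi_sigma_additive (tilt P t).
Proof.
move=> F mF tF mUF; rewrite /tilt ge0_integral_bigcup//.
- by apply: is_cvg_ereal_nneg_natsum_cond => n _ _; exact: tilt_ge0.
- by apply: measurable_funTS; exact: measurable_dens.
- by move=> x _; exact: dens_ge0.
Qed.

HB.instance Definition _ := isMeasure.Build _ _ _
  (tilt P t) tilt0 tilt_ge0 tilt_sigma_additive.

Lemma laplace_gt0 : 0 < laplace P t.
Proof.
rewrite lt_def laplace_ge0 andbT; apply/eqP => L0.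
have := (@ae_eq_integral_abs _ _ _ P setT measurableT _ measurable_expRM).1.
rewrite (_ : (\int[P]_x _) = 0); last first.
  by rewrite -[RHS]L0; apply: eq_integral => x _; rewrite gee0_abs.
move=> /(_ erefl) [N [mN PN0 sN]].
have NT : N = setT.
  rewrite -subTset => x _; apply: sN => /(_ Logic.I)/= [] /eqP.
  by rewrite gt_eqF// expR_gt0.
move: PN0; rewrite NT => PT0; have := probability_setT P.
by rewrite PT0 => /esym/eqP; rewrite onee_eq0.
Qed.

Lemma tilt_setT : laplace P t < +oo -> tilt P t setT = 1.
Proof.
move=> Loo; have Lfin : laplace P t \is a fin_num.
  by rewrite ge0_fin_numE// laplace_ge0.
have L0 : fine (laplace P t) != 0%R.
  by rewrite gt_eqF// fine_gt0// laplace_gt0.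
rewrite /tilt; under eq_integral do rewrite EFinM.
rewrite ge0_integralZr//.
- by rewrite -/(laplace P t) -{1}(fineK Lfin) -EFinM divff.
- exact: measurable_expRM.
- by rewrite lee_fin invr_ge0 fine_ge0// laplace_ge0.
Qed.

End tilt_measure.

Definition tilt_median_class (R : realType) :
    set (probability (measurableTypeR R) R) :=
  [set P | (forall t : R, (laplace P t < +oo)%E) /\
           (forall t : R,
              (tilt P t `]-oo, t[%classic <= (2^-1)%:E)%E /\
              ((2^-1)%:E <= tilt P t `]-oo, t]%classic)%E)].

(* Main.v *)
(** Let [k u = |u| exp (- u^2 / 2) / 2], a symmetric probability density, and
    let [m = exp (x^2 / 2) P(dx)].  After the factor [exp (- t^2 / 2)], the median
    condition says that [m] convolved with [sgn u * exp (- u^2 / 2)] vanishes at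
    every [t].  The distributional derivative of that kernel is [2 delta - 2 k], so
    [m] is invariant under convolution with [k]: it has a finite density [f], and
    [f = k * f].

    This Choquet-Deny equation is solved by concavity.  The bounded function
    [g = f / (1 + f)] satisfies [k * g <= g] by Jensen.  Test [g - k * g] against a
    centred Gaussian [L_s] of standard deviation [s]: since
    [k * L_s >= L_s / (1 + 1 / s^2)], the result is at most [1 / s^2], whereas
    [s L_s >= L_1].  Letting [s] go to infinity gives [k * g = g] almost everywhere.
    The equality case of Jensen forces [f] to be constant almost everywhere, so that
    [P] is proportional to [exp (- x^2 / 2) dx]. *)
Require Import Defs.
From HB Require Import structures.
From mathcomp Require Import all_boot all_order all_algebra.
From mathcomp Require Import all_classical all_reals all_analysis.
From mathcomp Require Import measurable_realfun ring lra.
Set Implicit Arguments.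
Unset Strict Implicit.
Unset Printing Implicit Defensive.
Import Order.TTheory GRing.Theory Num.Theory.
Import numFieldNormedType.Exports.
Local Open Scope classical_set_scope.
Local Open Scope ring_scope.

Section kernel.
Context {R : realType}.
Implicit Types u x t a b c s : R.
Local Notation mu := (@lebesgue_measure R).

Definition kern c u : R := `|u| * expR (- (c * u ^+ 2 / 2)) / 2.

Definition skern u : R := Num.sg u * (1 - expR (- (u ^+ 2 / 2))).

Lemma kern_ge0 c u : 0 <= kern c u.
Proof. by rewrite divr_ge0// mulr_ge0// expR_ge0. Qed.

Lemma kernN c u : kern c (- u) = kern c u.
Proof. by rewrite /kern normrN sqrrN. Qed.

Lemma is_derive_expR_quad c u :
  is_derive u 1 (fun u => expR (- (c * u ^+ 2 / 2)))
    (- (c * u * expR (- (c * u ^+ 2 / 2)))).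
Proof.
have -> : (fun u => expR (- (c * u ^+ 2 / 2))) =
    expR \o ((- (c / 2)) \*: (@id R ^+ 2)).
  by apply/funext => v /=; congr expR; rewrite /GRing.scale/=/GRing.scale/= fctE; ring.
apply: is_derive_eq; rewrite /GRing.scale/= fctE /=.
rewrite (_ : - (c / 2) *: u ^+ 2 = - (c * u ^+ 2 / 2)); last by rewrite /GRing.scale/=; field.
by field.
Qed.

Lemma continuous_expR_quad c : continuous (fun u => expR (- (c * u ^+ 2 / 2))).
Proof.
move=> u; apply/differentiable_continuous/derivable1_diffP.
by have [] := is_derive_expR_quad c u.
Qed.

Lemma continuous_kern c : continuous (kern c).
Proof.
move=> u; apply: cvgM; last exact: cvg_cst.
by apply: cvgM; [exact: norm_continuous|exact: continuous_expR_quad].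
Qed.

Lemma measurable_kern c : measurable_fun [set: R] (kern c).
Proof. by apply: continuous_measurable_fun; exact: continuous_kern. Qed.

Lemma integral_kern c : 0 < c -> (\int[mu]_x (kern c x)%:E = (c^-1)%:E)%E.
Proof.
move=> c0; rewrite ge0_symfun_integralT; last 3 first.
- exact: kern_ge0.
- exact: continuous_kern.
- by move=> x /=; rewrite kernN.
rewrite -set_itvcy.
pose F u := - (2 * c)^-1 * expR (- (c * u ^+ 2 / 2)).
have dF u : is_derive u 1 F (u * expR (- (c * u ^+ 2 / 2)) / 2).
  have := @is_deriveZ _ _ _ _ (- (2 * c)^-1) _ _ _ (is_derive_expR_quad c u).
  move=> h; apply: (is_derive_eq h); rewrite /GRing.scale/=.
  by field; rewrite gt_eqF.
rewrite (@ge0_continuous_FTC2y _ (kern c) F 0 0).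
- by rewrite /F expr0n/= mulr0 mul0r oppr0 expR0 mulr1 -EFinB sub0r opprK -EFinM;
  congr (_%:E); field; rewrite gt_eqF.
- by move=> x _; exact: kern_ge0.
- exact/continuous_subspaceT/continuous_kern.
- rewrite -(mulr0 (- (2 * c)^-1)); apply: cvgMr.
  apply: (cvg_comp (fun x => c * x ^+ 2 / 2) (fun x => expR (- x))); last exact: cvgr_expR.
  rewrite (_ : (fun x => c * x ^+ 2 / 2) = (fun x => x ^+ 2 * (c / 2)))%R.
    by apply/gt0_cvgMly; [exact: divr_gt0|exact: cvgr_expr2].
  by apply/funext => x; field.
- by move=> x _; have [] := dF x.
- apply: cvg_at_right_filter; apply/differentiable_continuous/derivable1_diffP.
  by have [] := dF 0.
- move=> x; rewrite in_itv/= andbT => x0.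
  by rewrite derive1E (@derive_val _ _ _ _ _ _ _ (dF x))/kern gtr0_norm.
Qed.

Lemma is_derive_skern u : is_derive u 1 skern (2 * kern 1 u).
Proof.
have E v : expR (- (v ^+ 2 / 2)) = expR (- (1 * v ^+ 2 / 2)) by rewrite mul1r.
have dE := is_derive_expR_quad 1 u.
have [u0|u0|->] := ltgtP u 0.
- apply: (@near_eq_is_derive R R^o R^o (fun v => expR (- (1 * v ^+ 2 / 2)) - 1)).
    near=> v; rewrite /skern ltr0_sg ?E//; first by ring.
    by near: v; exact: lt_nbhsl.
  apply: is_derive_eq.
  by rewrite /kern ltr0_norm// subr0; field.
- apply: (@near_eq_is_derive R R^o R^o (fun v => 1 - expR (- (1 * v ^+ 2 / 2)))).
    near=> v; rewrite /skern gtr0_sg ?E//; first by ring.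
    by near: v; exact: lt_nbhsr.
  apply: is_derive_eq.
  by rewrite /kern gtr0_norm// add0r; field.
- apply/is_derive1_caratheodory.
  exists (fun v => skern v / v); split.
  + move=> v; rewrite subr0 /skern sgr0 mul0r subr0.
    by have [->|v0] := eqVneq v 0; [rewrite sgr0 !(mul0r,mulr0)|rewrite divfK].
  + rewrite /prop_for /continuous_at (_ : skern 0 / 0 = 0); last by rewrite invr0 mulr0.
    apply/cvgr0Pnorm_le => e e0; near=> v.
    have v1 : `|v| <= e by near: v; apply: (@cvgr0_norm_le _ _ _ _ _ id) => //; exact: cvg_id.
    rewrite /skern.
    have [->|v0] := eqVneq v 0; first by rewrite sgr0 !mul0r normr0 ltW.
    rewrite !normrM normr_sg v0 mul1r normrV ?unitfE// ler_pdivrMr ?normr_gt0//.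
    have h1 : expR (- (v ^+ 2 / 2)) <= 1.
      by rewrite -[leRHS]expR0 ler_expR oppr_le0 divr_ge0// sqr_ge0.
    have h2 := expR_ge1Dx (- (v ^+ 2 / 2)).
    rewrite ger0_norm ?subr_ge0//.
    apply: (@le_trans _ _ (`|v| * `|v|)); last by rewrite ler_wpM2r.
    by rewrite -expr2 real_normK ?num_real//; have := sqr_ge0 v; lra.
  + by rewrite invr0 mulr0 /kern normr0 !(mul0r, mulr0).
Unshelve. all: by end_near. Qed.

Lemma continuous_skern : continuous skern.
Proof.
move=> u; apply/differentiable_continuous/derivable1_diffP.
by have [] := is_derive_skern u.
Qed.

Lemma integral_kern_itv a b x : a < b ->
  (\int[mu]_(t in `]a, b]) (kern 1 (x - t))%:E =
   ((skern (b - x) - skern (a - x)) / 2)%:E)%E.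
Proof.
move=> ab.
pose F t := skern (t - x) / 2.
have dF t : is_derive t 1 F (kern 1 (x - t)).
  have h : is_derive t 1 (fun t => t - x) 1 by apply: is_derive_eq; rewrite subr0.
  have h1 := @is_derive1_comp _ skern (fun t => t - x) t _ _ (is_derive_skern _) h.
  rewrite (_ : F = 2^-1 \*: (skern \o (fun t => t - x))); last first.
    by apply/funext => u /=; rewrite /F mulrC.
  by apply: is_derive_eq; rewrite -kernN opprB /GRing.scale/=; field.
have cF : continuous F.
  move=> t; apply/differentiable_continuous/derivable1_diffP.
  by have [] := dF t.
have ck : continuous (fun t => kern 1 (x - t)).
  move=> t; apply: (@continuous_comp _ _ _ (fun t : R => x - t) (kern 1)).
    by apply: cvgB; [exact: cvg_cst|exact: cvg_id].
  exact: continuous_kern.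
rewrite integral_itv_obnd_cbnd; last first.
  apply/measurable_EFinP; apply: measurable_funTS.
  exact: continuous_measurable_fun.
rewrite (@continuous_FTC2 _ _ F) //.
- by rewrite -EFinB -mulrBl.
- exact/continuous_subspaceT.
- split; first by move=> t _; have [] := dF t.
  + by apply: cvg_at_right_filter; exact: cF.
  + by apply: cvg_at_left_filter; exact: cF.
- by move=> t _; rewrite derive1E (@derive_val _ _ _ _ _ _ _ (dF t)).
Qed.

Lemma lebesgue_measure_reflect c (A : set (measurableTypeR R)) : measurable A ->
  pushforward mu ((fun x => c - x) : _ -> measurableTypeR R) A = mu A.
Proof.
move=> mA.
have mphi : measurable_fun setT ((fun x => c - x) : measurableTypeR R -> measurableTypeR R).
  exact: measurable_funB.
pose phi : {mfun measurableTypeR R >-> measurableTypeR R} :=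
  HB.pack ((fun x => c - x) : measurableTypeR R -> measurableTypeR R)
    (isMeasurableFun.Build _ _ _ _ _ mphi).
apply/esym; apply: (@lebesgue_measure_unique _ (pushforward mu phi)) => //= _ [[a b]] _ <-.
rewrite /pushforward.
rewrite (_ : _ @^-1` _ = `[c - b, c - a[%classic); last first.
  by apply/seteqP; split => x /=; rewrite !in_itv/=; lra.
rewrite !lebesgue_measure_itv/= !lte_fin ltrD2l ltrN2; case: ifP => // _.
by rewrite -!EFinB; congr (_%:E); ring.
Qed.

Lemma ge0_integral_reflect c (H : R -> \bar R) :
  measurable_fun [set: R] H -> (forall x, 0 <= H x)%E ->
  (\int[mu]_x H x = \int[mu]_x H (c - x)%R)%E.
Proof.
move=> mH H0.
have mphi : measurable_fun setT ((fun x => c - x) : measurableTypeR R -> measurableTypeR R).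
  exact: measurable_funB.
rewrite -[RHS](@ge0_integral_pushforward _ _ _ _ _ _ mphi mu setT H)//.
by apply: eq_measure_integral => A mA _; exact/esym/lebesgue_measure_reflect.
Qed.

Lemma integral_kern_sub x : (\int[mu]_t (kern 1 (x - t))%:E = 1)%E.
Proof.
rewrite -(@ge0_integral_reflect x (fun t => (kern 1 t)%:E)).
- by rewrite integral_kern// invr1.
- by apply/measurable_EFinP; exact: measurable_kern.
- by move=> t; rewrite lee_fin kern_ge0.
Qed.

Lemma ge0_integral_symmetrize (H : R -> R) :
  measurable_fun [set: R] H -> (forall x, 0 <= H x) ->
  (2%:E * \int[mu]_x (H x)%:E = \int[mu]_x (H x + H (- x))%:E)%E.
Proof.
move=> mH H0; under [RHS]eq_integral do rewrite EFinD.
have mHN : measurable_fun [set: R] (fun x => H (- x)) by exact: measurableT_comp.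
rewrite ge0_integralD//; last 4 first.
- by move=> x _; rewrite lee_fin.
- exact/measurable_EFinP.
- by move=> x _; rewrite lee_fin.
- exact/measurable_EFinP.
rewrite mule_natl mule2n; congr (_ + _)%E.
rewrite (@ge0_integral_reflect 0 (fun t => (H t)%:E)).
- by apply: eq_integral => t _; rewrite sub0r.
- exact/measurable_EFinP.
- by move=> t; rewrite lee_fin.
Qed.

(* Symmetrising in [t], this is [cosh >= 1] applied to the cross term of the
   shifted Gaussian. *)
Lemma kern_normal_fun_ge s x : s != 0 ->
  (((1 + (s ^+ 2)^-1)^-1 * normal_fun 0 s x)%:E <=
   \int[mu]_t (kern 1 (x - t) * normal_fun 0 s t)%:E)%E.
Proof.
move=> s0.
have s2 : 0 < s ^+ 2 by rewrite exprn_even_gt0.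
have mn : measurable_fun [set: R] (fun t => normal_fun 0 s (x - t)).
  apply: measurableT_comp; first exact: measurable_normal_fun.
  exact: measurable_funB.
have mH : measurable_fun [set: R] (fun t => kern 1 t * normal_fun 0 s (x - t)).
  by apply: measurable_funM => //; exact: measurable_kern.
have H0 t : 0 <= kern 1 t * normal_fun 0 s (x - t).
  by rewrite mulr_ge0 ?kern_ge0// expR_ge0.
have -> : (\int[mu]_t (kern 1 (x - t) * normal_fun 0 s t)%:E =
    \int[mu]_t (kern 1 t * normal_fun 0 s (x - t))%:E)%E.
  rewrite (@ge0_integral_reflect x (fun t => (kern 1 t * normal_fun 0 s (x - t))%:E)).
  - by apply: eq_integral => t _; rewrite opprB addrCA subrr addr0.
  - exact/measurable_EFinP.
  - by move=> t; rewrite lee_fin.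
have c0 : 0 < 1 + (s ^+ 2)^-1 by rewrite addr_gt0// invr_gt0.
rewrite -(@lee_pmul2l _ 2%:E)// ge0_integral_symmetrize//.
rewrite -EFinM mulrCA mulrC EFinM -(integral_kern c0).
have k0 : (0 <= (2 * normal_fun 0 s x)%:E)%E by rewrite lee_fin mulr_ge0// expR_ge0.
have mk : measurable_fun [set: R] (fun t => (kern (1 + (s ^+ 2)^-1) t)%:E).
  by apply/measurable_EFinP; exact: measurable_kern.
rewrite -ge0_integralZl//; last by move=> t _; rewrite lee_fin kern_ge0.
apply: ge0_le_integral => //.
- by move=> t _; rewrite mule_ge0// lee_fin kern_ge0.
- exact: measurable_funeM.
- apply/measurable_EFinP; apply: measurable_funD => //.
  exact: (measurableT_comp mH).
move=> t _; rewrite -EFinM lee_fin /kern /normal_fun !subr0.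
rewrite sqrrN normrN.
pose w := x * t / s ^+ 2.
pose E0 := expR (- (1 * t ^+ 2 / 2)) * expR (- (x ^+ 2 + t ^+ 2) / (s ^+ 2 *+ 2)).
have e1 : expR (- (1 * t ^+ 2 / 2)) * expR (- (x - t) ^+ 2 / (s ^+ 2 *+ 2)) = E0 * expR w.
  by rewrite /E0 -!expRD; congr expR; rewrite /w; field.
have e2 : expR (- (1 * t ^+ 2 / 2)) * expR (- (x - - t) ^+ 2 / (s ^+ 2 *+ 2)) = E0 * expR (- w).
  by rewrite /E0 -!expRD; congr expR; rewrite /w; field.
have e3 : expR (- ((1 + (s ^+ 2)^-1) * t ^+ 2 / 2)) * expR (- x ^+ 2 / (s ^+ 2 *+ 2)) = E0.
  by rewrite /E0 -!expRD; congr expR; field.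
have w1 := expR_ge1Dx w; have w2 := expR_ge1Dx (- w).
have E00 : 0 <= E0 by rewrite mulr_ge0 ?expR_ge0.
apply: (@le_trans _ _ (`|t| / 2 * (E0 * (expR w + expR (- w))))); last first.
  by rewrite mulrDr -e1 -e2 le_eqVlt; apply/orP; left; apply/eqP; ring.
apply: (@le_trans _ _ (`|t| / 2 * (E0 * 2))).
  by rewrite -e3 le_eqVlt; apply/orP; left; apply/eqP; field.
by rewrite ler_wpM2l ?divr_ge0// ler_wpM2l//; lra.
Qed.

End kernel.

Section weighted_integral.
Context {R : realType}.
Local Notation mu := (@lebesgue_measure R).
Local Notation mR := (measurableTypeR R).
Local Open Scope ereal_scope.

Lemma ge0_integral_measure d (T : measurableType d)
    (m : {measure set T -> \bar R}) (f : T -> \bar R) :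
  measurable_fun setT f -> (forall x, 0 <= f x) ->
  exists nu : {measure set T -> \bar R}, forall A, nu A = \int[m]_(x in A) f x.
Proof.
move=> mf f0.
have h0 : (fun A => \int[m]_(x in A) f x) set0 = 0 by exact: integral_set0.
have hge A : 0 <= \int[m]_(x in A) f x by exact: integral_ge0.
have hsig : semi_sigma_additive (fun A => \int[m]_(x in A) f x).
  move=> F mF tF mUF; rewrite ge0_integral_bigcup//.
  - by apply: is_cvg_ereal_nneg_natsum_cond => n _ _; exact: hge.
  - exact: measurable_funTS.
pose nu : {measure set T -> \bar R} :=
  HB.pack (fun A => \int[m]_(x in A) f x) (isMeasure.Build _ _ _ _ h0 hge hsig).
by exists nu.
Qed.

Lemma ge0_integralD_EFin d (T : measurableType d) (m : {measure set T -> \bar R})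
    (f g : T -> R) :
  measurable_fun setT f -> measurable_fun setT g ->
  (forall x, 0 <= f x)%R -> (forall x, 0 <= g x)%R ->
  \int[m]_x (f x + g x)%:E = \int[m]_x (f x)%:E + \int[m]_x (g x)%:E.
Proof.
move=> mf mg f0 g0; under eq_integral do rewrite EFinD.
rewrite ge0_integralD//.
- by move=> x _; rewrite lee_fin.
- exact/measurable_EFinP.
- by move=> x _; rewrite lee_fin.
- exact/measurable_EFinP.
Qed.

Lemma ge0_integralZl_EFinM d (T : measurableType d) (m : {measure set T -> \bar R})
    (f : T -> R) (c : R) :
  measurable_fun setT f -> (forall x, 0 <= f x)%R -> (0 <= c)%R ->
  \int[m]_x (c * f x)%:E = c%:E * \int[m]_x (f x)%:E.
Proof.
move=> mf f0 c0; under eq_integral do rewrite EFinM.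
by rewrite ge0_integralZl_EFin//; [move=> x _; rewrite lee_fin|exact/measurable_EFinP].
Qed.

Lemma integral_indicM (m : {measure set mR -> \bar R}) (g : mR -> R) (D : set mR) :
  \int[m]_(x in D) (g x)%:E = \int[m]_x (g x * \1_D x)%:E.
Proof.
rewrite integral_mkcond; apply: eq_integral => x _.
by rewrite patchE indicE; case: ifPn => _; rewrite ?mulr1 ?mulr0.
Qed.

Lemma eq_integral_itvoc (m1 m2 : {measure set mR -> \bar R}) (f1 f2 : mR -> \bar R) :
  measurable_fun setT f1 -> measurable_fun setT f2 ->
  (forall x, 0 <= f1 x) -> (forall x, 0 <= f2 x) ->
  (forall a b : R, (a < b)%R ->
    \int[m1]_(x in `]a, b]%classic) f1 x = \int[m2]_(x in `]a, b]%classic) f2 x) ->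
  (forall a b : R, \int[m1]_(x in `]a, b]%classic) f1 x < +oo) ->
  forall A, measurable A -> \int[m1]_(x in A) f1 x = \int[m2]_(x in A) f2 x.
Proof.
move=> mf1 mf2 f10 f20 f12 f1oo A mA.
have [nu1 nu1E] := ge0_integral_measure m1 mf1 f10.
have [nu2 nu2E] := ge0_integral_measure m2 mf2 f20.
rewrite -nu1E -nu2E.
refine (@measure_unique _ _ _ (@measurable _ (ocitv_type R) : set (set mR))
  (fun n : nat => `](- n%:R : R)%R, (n%:R : R)%R]%classic : set mR) _ _ _ _ nu1 nu2 _ _ A mA) => //.
- by move=> B C mB mC; exact: (@measurableI _ (ocitv_type R)).
- by move=> n; exact: is_ocitv.
- rewrite -subTset => x _; exists (Num.truncn `|x|%R).+1 => //=.
  have := Num.Theory.truncnS_gt `|x|%R.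
  rewrite in_itv/= => h; apply/andP; split.
    by rewrite ltrNl (le_lt_trans _ h)// -normrN ler_norm.
  by rewrite ltW// (le_lt_trans _ h)// ler_norm.
- move=> _ [[a b]] _ <-/=; rewrite nu1E nu2E.
  have [ab|ba] := ltP a b; first exact: f12.
  by rewrite set_itv_ge ?bnd_simp -?leNgt// !integral_set0.
- by move=> n /=; rewrite nu1E.
Qed.

Lemma ge0_integral_layer_cake (m : {sigma_finite_measure set mR -> \bar R})
    (w H : mR -> R) :
  measurable_fun setT w -> measurable_fun setT H ->
  (forall x, 0 <= w x)%R -> (forall x, 0 <= H x)%R ->
  \int[m]_x (H x * w x)%:E =
  \int[mu]_y \int[m]_(x in [set x | 0 <= y < H x]%R) (w x)%:E.
Proof.
move=> mw mH w0 H0.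
pose S : set (mR * mR) := [set p | 0 <= p.2 < H p.1]%R.
have mS : measurable S.
  have mb : measurable_fun setT (fun p : mR * mR => (0 <= p.2)%R && (p.2 < H p.1)%R).
    apply: measurable_and; first exact: measurable_fun_ler.
    by apply: measurable_fun_ltr => //; exact: measurableT_comp.
  rewrite (_ : S = setT `&` (fun p : mR * mR => (0 <= p.2)%R && (p.2 < H p.1)%R) @^-1` [set true]).
    exact: mb.
  by rewrite setTI; apply/seteqP; split => p /=.
pose K p := (w p.1 * \1_S p)%:E.
have mK : measurable_fun setT K.
  apply/measurable_EFinP; apply: measurable_funM; last exact: measurable_indic.
  exact: measurableT_comp.
have K0 p : 0 <= K p by rewrite lee_fin mulr_ge0// indicE.
transitivity (\int[m]_x \int[mu]_y K (x, y)).
  apply: eq_integral => x _.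
  transitivity (\int[mu]_y ((w x)%:E * (\1_(`[0%R, H x[%classic) y)%:E)); last first.
    apply: eq_integral => y _; rewrite /K EFinM !indicE /=.
    have -> // : ((x, y) \in S) = (y \in `[0%R, H x[%classic).
    by apply/idP/idP; rewrite !inE /S/= ?in_itv//=.
  rewrite ge0_integralZl_EFin//; last first.
    by apply/measurable_EFinP; exact: measurable_indic.
  rewrite integral_indic//= setIT lebesgue_measure_itv/= lte_fin.
  case: ifPn => Hx; first by rewrite oppr0 adde0 -EFinM mulrC.
  rewrite mule0 (_ : H x = 0%R) ?mul0r//.
  by apply/eqP; rewrite eq_le H0 andbT leNgt.
rewrite fubini_tonelli//; apply: eq_integral => y _.
rewrite [RHS]integral_mkcond; apply: eq_integral => x _.
rewrite /K patchE indicE /=.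
have -> : ((x, y) \in S) = (x \in [set x | (0 <= y < H x)%R]).
  by apply/idP/idP; rewrite !inE.
by case: ifPn => _; rewrite ?mulr1 ?mulr0.
Qed.

Lemma eq_integral_weighted (m1 m2 : {sigma_finite_measure set mR -> \bar R})
    (w1 w2 H : mR -> R) :
  measurable_fun setT w1 -> measurable_fun setT w2 -> measurable_fun setT H ->
  (forall x, 0 <= w1 x)%R -> (forall x, 0 <= w2 x)%R -> (forall x, 0 <= H x)%R ->
  (forall A, measurable A ->
    \int[m1]_(x in A) (w1 x)%:E = \int[m2]_(x in A) (w2 x)%:E) ->
  \int[m1]_x (H x * w1 x)%:E = \int[m2]_x (H x * w2 x)%:E.
Proof.
move=> mw1 mw2 mH w10 w20 H0 w12.
rewrite !ge0_integral_layer_cake//; apply: eq_integral => y _; apply: w12.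
rewrite (_ : [set x | _] = setT `&` (fun x => (0 <= y)%R && (y < H x)%R) @^-1` [set true]).
  apply: measurable_and => //.
  by apply: measurable_fun_ltr.
by rewrite setTI; apply/seteqP; split => x /=.
Qed.

End weighted_integral.

Section tilted_density.
Context {R : realType} (P : probability (measurableTypeR R) R).
Local Notation mu := (@lebesgue_measure R).
Local Notation mR := (measurableTypeR R).
Implicit Types t a b : R.

Definition gweight (x : R) : R := expR (x ^+ 2 / 2).

Definition tweight t (x : R) : R := expR (t * x - t ^+ 2 / 2).

(* The density of [e^{x^2/2} P(dx)], once [P] is in the class. *)
Definition tdens t : \bar R := (\int[P]_x (kern 1 (x - t) * gweight x)%:E)%E.

Lemma gweight_ge0 x : 0 <= gweight x. Proof. exact: expR_ge0. Qed.

Lemma tweight_ge0 t x : 0 <= tweight t x. Proof. exact: expR_ge0. Qed.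

Lemma measurable_gweight : measurable_fun [set: mR] gweight.
Proof.
by apply: measurableT_comp => //; apply: measurable_funM.
Qed.

Lemma measurable_tweight t : measurable_fun [set: mR] (tweight t).
Proof.
by apply: measurableT_comp => //; apply: measurable_funB.
Qed.

Lemma measurable_kern_gweight :
  measurable_fun [set: mR * mR] (fun p => kern 1 (p.1 - p.2) * gweight p.1).
Proof.
apply: measurable_funM.
  apply: measurableT_comp; first exact: measurable_kern.
  exact: measurable_funB.
by apply: measurableT_comp => //; exact: measurable_gweight.
Qed.

Lemma kern_gweight_ge0 t x : 0 <= kern 1 (x - t) * gweight x.
Proof. by rewrite mulr_ge0 ?kern_ge0 ?gweight_ge0. Qed.

Lemma tweightE t x : tweight t x = gweight x * expR (- ((t - x) ^+ 2 / 2)).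
Proof. by rewrite /tweight /gweight -expRD; congr expR; field. Qed.

Lemma integral_tdens_itv a b : a < b ->
  (\int[mu]_(t in `]a, b]) tdens t =
   \int[P]_x ((skern (b - x) - skern (a - x)) / 2 * gweight x)%:E)%E.
Proof.
move=> ab.
pose K (p : mR * mR) : \bar R :=
  (kern 1 (p.1 - p.2) * gweight p.1 * \1_(`]a, b]%classic) p.2)%:E.
have mK : measurable_fun setT K.
  apply/measurable_EFinP; apply: measurable_funM; first exact: measurable_kern_gweight.
  by apply: measurableT_comp => //; exact: measurable_indic.
have K0 p : (0 <= K p)%E.
  by rewrite lee_fin mulr_ge0 ?kern_gweight_ge0// indicE.
transitivity (\int[mu]_t \int[P]_x K (x, t))%E.
  rewrite integral_mkcond; apply: eq_integral => t _.
  rewrite patchE /K; case: ifPn => tab.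
    by apply: eq_integral => x _; rewrite /= indicE tab mulr1.
  by rewrite integral0_eq// => x _; rewrite /= indicE (negbTE tab) mulr0.
rewrite -(fubini_tonelli K)//; apply: eq_integral => x _.
rewrite EFinM -integral_kern_itv// muleC.
rewrite -ge0_integralZl_EFin ?gweight_ge0//; last 2 first.
- by move=> t _; rewrite lee_fin kern_ge0.
- apply/measurable_EFinP; apply: measurableT_comp; first exact: measurable_kern.
  exact: measurable_funB.
rewrite [RHS]integral_mkcond; apply: eq_integral => t _.
by rewrite /K patchE indicE /=; case: ifPn => _; rewrite ?mulr1 ?mulr0// -EFinM mulrC.
Qed.

Lemma kern_gweight_bound a b t x : a <= t <= b ->
  kern 1 (x - t) * gweight x <= expR (1 / 2) *
    (expR ((a + 1) * x) + expR ((b + 1) * x) +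
     (expR ((a - 1) * x) + expR ((b - 1) * x))).
Proof.
move=> /andP[at_ tb].
have mono s : expR ((t + s) * x) <= expR ((a + s) * x) + expR ((b + s) * x).
  have [x0|x0] := leP 0 x.
    by rewrite (@le_trans _ _ (expR ((b + s) * x))) ?lerDr ?expR_ge0// ler_expR ler_wpM2r// lerD2r.
  by rewrite (@le_trans _ _ (expR ((a + s) * x))) ?lerDl ?expR_ge0// ler_expR ler_nM2r// lerD2r.
have E s : s ^+ 2 = 1 ->
    expR (s * (x - t)) * tweight t x <= expR (1 / 2) * expR ((t + s) * x).
  move=> s1; rewrite -!expRD ler_expR -subr_ge0.
  rewrite [leRHS](_ : _ = (t + s) ^+ 2 / 2 + (1 - s ^+ 2) / 2); last by field.
  by rewrite s1 subrr mul0r addr0 divr_ge0// sqr_ge0.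
have habs : `|x - t| <= expR (1 * (x - t)) + expR ((- 1) * (x - t)).
  have h1 := expR_ge1Dx (1 * (x - t)); have h2 := expR_ge1Dx ((- 1) * (x - t)).
  have h3 := expR_ge0 (1 * (x - t)); have h4 := expR_ge0 ((- 1) * (x - t)).
  by rewrite ler_norml; apply/andP; split; lra.
have -> : kern 1 (x - t) * gweight x = 2^-1 * (`|x - t| * tweight t x).
  rewrite tweightE /kern mul1r (_ : (x - t) ^+ 2 = (t - x) ^+ 2); last by ring.
  by ring.
have e1 := E 1 (expr1n _ _); have e2 := E (-1) (sqrr_sign _ 1).
have := mono 1; have := mono (-1) => m2 m1.
have h5 : `|x - t| * tweight t x <= expR (1 / 2) * (expR ((t + 1) * x) + expR ((t + -1) * x)).
  apply: (le_trans (ler_wpM2r (tweight_ge0 t x) habs)).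
  by rewrite [leLHS]mulrDl [leRHS]mulrDr lerD.
apply: (@le_trans _ _ (expR (1 / 2) * (expR ((t + 1) * x) + expR ((t + -1) * x)))).
  apply: le_trans h5; rewrite ler_piMl//; last lra.
  by rewrite mulr_ge0 ?tweight_ge0.
by rewrite ler_wpM2l ?expR_ge0// lerD.
Qed.

End tilted_density.

Section median_class.
Context {R : realType} (P : probability (measurableTypeR R) R).
Context (Poo : forall t : R, (laplace P t < +oo)%E).
Local Notation mu := (@lebesgue_measure R).
Local Notation mR := (measurableTypeR R).
Implicit Types t a b : R.

Lemma integrable_expRM t : P.-integrable setT (fun x : mR => (expR (t * x))%:E).
Proof.
apply/integrableP; split; first exact: measurable_expRM.
by under eq_integral do rewrite gee0_abs ?lee_fin ?expR_ge0//; exact: Poo.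
Qed.

Lemma tdens_ge0 t : (0 <= tdens P t)%E.
Proof. by apply: integral_ge0 => x _; rewrite lee_fin kern_gweight_ge0. Qed.

Lemma measurable_tdens : measurable_fun [set: mR] (tdens P).
Proof.
apply: (@measurable_fun_fubini_tonelli_G _ _ _ _ _ P (fun p : mR * mR => (kern 1 (p.1 - p.2) * gweight p.1)%:E)).
- by apply/measurable_EFinP; exact: measurable_kern_gweight.
- by move=> p; rewrite lee_fin kern_gweight_ge0.
Qed.

Lemma tdens_bound a b :
  exists2 C : R, 0 <= C & forall t, a <= t <= b -> (tdens P t <= C%:E)%E.
Proof.
pose g x := expR (1 / 2) *
    (expR ((a + 1) * x) + expR ((b + 1) * x) +
     (expR ((a - 1) * x) + expR ((b - 1) * x))).
have ig : P.-integrable setT (fun x : mR => (g x)%:E).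
  have i2 (c d : R) : P.-integrable setT (fun x : mR => (expR (c * x))%:E + (expR (d * x))%:E)%E.
    by apply: integrableD => //; exact: integrable_expRM.
  have i4 := integrableD measurableT (i2 (a + 1) (b + 1)) (i2 (a - 1) (b - 1)).
  exact: (integrableZl measurableT (expR (1 / 2)) i4).
have g0 x : 0 <= g x by rewrite mulr_ge0 ?addr_ge0 ?expR_ge0.
have mg : measurable_fun [set: mR] (fun x : mR => (g x)%:E).
  exact: measurable_int ig.
have gfin : (\int[P]_x (g x)%:E)%E \is a fin_num by exact: integrable_fin_num.
exists (fine (\int[P]_x (g x)%:E)%E).
  by rewrite fine_ge0// integral_ge0// => x _; rewrite lee_fin.
move=> t tab; rewrite fineK//; apply: ge0_le_integral => //.
- by move=> x _; rewrite lee_fin kern_gweight_ge0.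
- apply/measurable_EFinP; exact: (measurableT_comp measurable_kern_gweight (pair2_measurable t)).
- by move=> x _; rewrite lee_fin kern_gweight_bound.
Qed.

Lemma tdens_fin_num t : tdens P t \is a fin_num.
Proof.
have [C _ /(_ t)] := tdens_bound t t.
rewrite lexx => /(_ isT) h.
by rewrite ge0_fin_numE ?tdens_ge0// (le_lt_trans h)// ltry.
Qed.

Lemma integral_tweight t (D : set mR) : measurable D ->
  (\int[P]_(x in D) (tweight t x)%:E =
   (fine (laplace P t) * expR (- (t ^+ 2 / 2)))%:E * tilt P t D)%E.
Proof.
move=> mD; have L0 : 0 < fine (laplace P t).
  by rewrite fine_gt0// laplace_gt0 /= Poo.
rewrite /tilt -ge0_integralZl_EFin//.
- apply: eq_integral => x _; rewrite -EFinM /tweight expRD; congr (_%:E).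
  by field; rewrite gt_eqF.
- by move=> x _; rewrite lee_fin divr_ge0 ?expR_ge0// ltW.
- apply: measurable_funTS; apply/measurable_EFinP; apply: measurable_funM => //.
  by apply/measurable_EFinP; exact: measurable_expRM.
- by rewrite mulr_ge0 ?expR_ge0// ltW.
Qed.

Lemma integral_tweightT t :
  (\int[P]_x (tweight t x)%:E = (fine (laplace P t) * expR (- (t ^+ 2 / 2)))%:E)%E.
Proof. by rewrite integral_tweight// tilt_setT// mule1. Qed.

Local Notation It t := (fine (laplace P t) * expR (- (t ^+ 2 / 2))).

(* Integrated form of [skern' = 2 kern], arranged so that every term is
   nonnegative. *)
Lemma gweight_itv_balance a b (c : bool) : a < b ->
  (2%:E * \int[mu]_(t in `]a, b]) tdens P t +
   (2%:E * \int[P]_(x in [set` Interval -oo%O (BSide c b)]) (tweight b x)%:E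
    + (It a)%:E) =
   2%:E * \int[P]_(x in [set` Interval (BRight a) (BSide c b)]) (gweight x)%:E +
   (2%:E * \int[P]_(x in `]-oo, a]) (tweight a x)%:E + (It b)%:E))%E.
Proof.
move=> ab; rewrite integral_tdens_itv// -(integral_tweightT a) -(integral_tweightT b).
rewrite (integral_indicM P (tweight b) [set` Interval -oo%O (BSide c b)]).
rewrite (integral_indicM P (tweight a) `]-oo, a]%classic).
rewrite (integral_indicM P gweight).
have mi (D : set mR) : measurable D -> measurable_fun [set: mR] (\1_D : mR -> R).
  by move=> mD; exact: measurable_indic.
have mS : measurable_fun [set: mR]
    (fun x : mR => (skern (b - x) - skern (a - x)) / 2 * gweight x).
  have ms t : measurable_fun [set: mR] (fun x : mR => skern (t - x)).
    apply: measurableT_comp; last exact: measurable_funB.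
    by apply: continuous_measurable_fun; exact: continuous_skern.
  apply: measurable_funM; last exact: measurable_gweight.
  by apply: measurable_funM => //; exact: measurable_funB.
have S0 x : 0 <= (skern (b - x) - skern (a - x)) / 2 * gweight x.
  rewrite mulr_ge0 ?gweight_ge0// -lee_fin -integral_kern_itv//.
  by apply: integral_ge0 => t _; rewrite lee_fin kern_ge0.
have H1 (D : set mR) t x : 0 <= tweight t x * \1_D x.
  by rewrite mulr_ge0 ?tweight_ge0// indicE.
have mH1 (D : set mR) t : measurable D ->
    measurable_fun [set: mR] (fun x : mR => tweight t x * \1_D x).
  by move=> mD; apply: measurable_funM; [exact: measurable_tweight|exact: mi].
have H2 (D : set mR) x : 0 <= gweight x * \1_D x.
  by rewrite mulr_ge0 ?gweight_ge0// indicE.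
have mH2 (D : set mR) : measurable D ->
    measurable_fun [set: mR] (fun x : mR => gweight x * \1_D x).
  by move=> mD; apply: measurable_funM; [exact: measurable_gweight|exact: mi].
have me t := measurable_tweight t.
have e0 t := @tweight_ge0 R t.
have m1 := mH1 [set` Interval -oo%O (BSide c b)] b (measurable_itv _).
have m2 := mH1 `]-oo, a]%classic a (measurable_itv _).
have m3 := mH2 [set` Interval (BRight a) (BSide c b)] (measurable_itv _).
have m2Z (f : mR -> R) : measurable_fun setT f -> measurable_fun setT (fun x => 2 * f x).
  by move=> mf; exact: measurable_funM.
have p2 (f : mR -> R) : (forall x, 0 <= f x) -> forall x, 0 <= 2 * f x.
  by move=> f0 x; rewrite mulr_ge0.
have two0 : 0 <= 2 :> R by [].
rewrite -(ge0_integralZl_EFinM P mS S0 two0).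
rewrite -(ge0_integralZl_EFinM P m1 (H1 _ _) two0).
rewrite -(ge0_integralZl_EFinM P m2 (H1 _ _) two0).
rewrite -(ge0_integralZl_EFinM P m3 (H2 _) two0).
rewrite -(ge0_integralD_EFin P (m2Z _ m1) (me a) (p2 _ (H1 _ _)) (e0 a)).
rewrite -(ge0_integralD_EFin P (m2Z _ m2) (me b) (p2 _ (H1 _ _)) (e0 b)).
rewrite -ge0_integralD_EFin; last 4 first.
- exact: m2Z.
- by apply: measurable_funD => //; exact: m2Z.
- exact: p2.
- by move=> x; rewrite !addr_ge0// mulr_ge0.
rewrite -ge0_integralD_EFin; last 4 first.
- exact: m2Z.
- by apply: measurable_funD => //; exact: m2Z.
- exact: p2.
- by move=> x; rewrite !addr_ge0// mulr_ge0.
apply: eq_integral => x _; congr (_%:E).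
rewrite !tweightE /skern !indicE !mem_setE !in_itv /=.
have E1 t : x = t -> expR (- ((t - x) ^+ 2 / 2)) = 1.
  by move=> ->; rewrite subrr expr0n/= mul0r oppr0 expR0.
set ea := expR (- ((a - x) ^+ 2 / 2)); set eb := expR (- ((b - x) ^+ 2 / 2)).
have [xa|xa|xa] := ltgtP x a.
- have xb := lt_trans xa ab.
  rewrite !gtr0_sg ?subr_gt0//=.
  by case: c {m1 m3} => /=; rewrite ?xb ?(ltW xb)/=; field.
- have [xb|xb|xb] := ltgtP x b.
  + rewrite gtr0_sg ?subr_gt0// ltr0_sg ?subr_lt0//.
    by case: c {m1 m3} => /=; rewrite ?xb ?(ltW xb)/=; field.
  + rewrite !ltr0_sg ?subr_lt0//.
    by case: c {m1 m3} => /=; rewrite ?(lt_gtF xb) ?(lt_geF xb)/=; field.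
  + rewrite /eb (E1 _ xb) xb subrr sgr0 ltr0_sg ?subr_lt0//.
    by case: c {m1 m3} => /=; rewrite ?ltxx ?lexx/=; field.
- rewrite /ea (E1 _ xa) xa subrr sgr0 gtr0_sg ?subr_gt0//.
  by case: c {m1 m3} => /=; rewrite ?ab ?(ltW ab)/=; field.
Qed.

End median_class.

Section tilted_density_equation.
Context {R : realType} (P : probability (measurableTypeR R) R).
Context (PM : tilt_median_class P).
Local Notation mu := (@lebesgue_measure R).
Local Notation mR := (measurableTypeR R).
Implicit Types t a b : R.
Local Open Scope ereal_scope.

Let Poo t : laplace P t < +oo. Proof. exact: PM.1. Qed.

Lemma tilt_le1 t (D : set mR) : measurable D -> tilt P t D <= 1.
Proof. by move=> mD; rewrite -(tilt_setT (Poo t)) le_measure// inE. Qed.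

Lemma tilt_fin_num t (D : set mR) : measurable D -> tilt P t D \is a fin_num.
Proof.
move=> mD; rewrite ge0_fin_numE ?measure_ge0//.
by rewrite (le_lt_trans (tilt_le1 t mD))// ltry.
Qed.

Lemma integral_tdens_itv_bound a b : (a < b)%R ->
  exists2 C : R, (0 <= C)%R & forall s r, (a <= s)%R -> (s < r)%R -> (r <= b)%R ->
    \int[mu]_(t in `]s, r]) tdens P t <= (C * (r - s))%:E.
Proof.
move=> ab; have [C C0 hC] := tdens_bound Poo a b.
exists C => // s r as_ sr rb.
have -> : (C * (r - s))%:E = \int[mu]_(t in `]s, r]) C%:E.
  by rewrite integral_cst//= lebesgue_measure_itv/= lte_fin sr -EFinB -EFinM.
apply: ge0_le_integral => //.
- by move=> t _; exact: tdens_ge0.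
- by apply: measurable_funTS; exact: measurable_tdens.
- move=> t /=; rewrite in_itv/= => /andP[st tr]; apply: hC.
  by rewrite (le_trans as_ (ltW st)) (le_trans tr rb).
Qed.

Lemma integral_tdens_itv_fin_num a b : (a < b)%R ->
  \int[mu]_(t in `]a, b]) tdens P t \is a fin_num.
Proof.
move=> ab; have [C C0 /(_ a b (lexx _) ab (lexx _)) h] := integral_tdens_itv_bound ab.
rewrite ge0_fin_numE ?(le_lt_trans h) ?ltry//.
by apply: integral_ge0 => t _; exact: tdens_ge0.
Qed.

Local Notation It t := (fine (laplace P t) * expR (- (t ^+ 2 / 2)))%R.

Let It_ge0 t : (0 <= It t)%R.
Proof. by rewrite mulr_ge0 ?expR_ge0// fine_ge0// laplace_ge0. Qed.

Lemma integral_gweight_itvoo_le a b : (a < b)%R ->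
  \int[P]_(x in `]a, b[) (gweight x)%:E <= \int[mu]_(t in `]a, b]) tdens P t.
Proof.
move=> ab; have := gweight_itv_balance Poo true ab.
rewrite (integral_tweight Poo b (measurable_itv _)).
rewrite (integral_tweight Poo a (measurable_itv _)).
have [B1 _] := PM.2 b; have [_ A1] := PM.2 a.
have := tilt_fin_num b (measurable_itv `]-oo, b[).
have := tilt_fin_num a (measurable_itv `]-oo, a]).
set tA := tilt P a _ in A1 *; set tB := tilt P b _ in B1 *.
case: tA A1 => // rA; rewrite lee_fin => A1 _.
case: tB B1 => // rB; rewrite lee_fin => B1 _.
have Ffin := integral_tdens_itv_fin_num ab.
set F := \int[mu]_(t in _) _ in Ffin *.
set M := \int[P]_(x in _) _.
case: F Ffin => // rF _.
have M0 : 0 <= M by apply: integral_ge0 => x _; rewrite lee_fin gweight_ge0.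
case: M M0 => [rM||//] _; last first.
  by rewrite -!EFinM -!EFinD gt0_muley ?lte_fin// addye.
have := ler_wpM2l (It_ge0 b) B1; have := ler_wpM2l (It_ge0 a) A1.
rewrite -!EFinM -!EFinD lee_fin => + + [].
move: (It a) (It b) => u v; move: (u * rA)%R (v * rB)%R => p q; clear; lra.
Qed.

Lemma no_atom (y : R) : P [set y] = 0.
Proof.
have w0 : \int[P]_(x in [set y]) (gweight x)%:E = (gweight y)%:E * P [set y].
  rewrite (eq_integral (cst (gweight y)%:E)) ?integral_cst//.
  by move=> x; rewrite inE/= => ->.
have y11 : (y - 1 < y + 1)%R by lra.
have [C C0 hC] := integral_tdens_itv_bound y11.
suff : \int[P]_(x in [set y]) (gweight x)%:E <= 0.
  rewrite w0 pmule_rle0 ?lte_fin ?expR_gt0// => h.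
  by apply/eqP; rewrite eq_le h measure_ge0.
apply/lee_addgt0Pr => e e0; rewrite add0e.
pose d := Num.min 1%R (e / (2 * (C + 1)))%R.
have C1 : (0 < C + 1)%R by lra.
have d0 : (0 < d)%R by rewrite lt_min ltr01 divr_gt0// mulr_gt0.
have d1 : (d <= 1)%R by rewrite ge_min lexx.
have de : (d * (2 * (C + 1)) <= e)%R.
  by rewrite -ler_pdivlMr ?mulr_gt0// ge_min lexx orbT.
have yd : (y - d < y + d)%R by lra.
apply: (@le_trans _ _ (\int[P]_(x in `](y - d)%R, (y + d)%R[) (gweight x)%:E)).
  apply: ge0_subset_integral => //.
  - by apply: measurable_funTS; apply/measurable_EFinP; exact: measurable_gweight.
  - by move=> x _; rewrite lee_fin gweight_ge0.
  - by move=> x /= ->; rewrite in_itv/=; lra.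
apply: (le_trans (integral_gweight_itvoo_le yd)).
apply: (le_trans (hC _ _ _ yd _)); [lra|lra|].
rewrite lee_fin; apply: le_trans de; nra.
Qed.

Lemma tilt_itvNyc t : tilt P t `]-oo, t]%classic = (2^-1)%:E.
Proof.
have [h1 h2] := PM.2 t; apply/eqP; rewrite eq_le h2 andbT.
have s0 : tilt P t [set t] = 0.
  apply: null_set_integral => //; last exact: no_atom.
  apply: measurable_funTS; apply/measurable_EFinP; apply: measurable_funM => //.
  by apply/measurable_EFinP; exact: measurable_expRM.
rewrite -(@setUitv1 _ _ -oo%O t true)//.
apply: (@le_trans _ _ (tilt P t `]-oo, t[%classic + tilt P t [set t])).
  exact: measureU2.
by rewrite s0 adde0.
Qed.

Lemma integral_gweightE (A : set mR) : measurable A ->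
  \int[P]_(x in A) (gweight x)%:E = \int[mu]_(t in A) tdens P t.
Proof.
have itvE a b : (a < b)%R ->
    \int[P]_(x in `]a, b]%classic) (gweight x)%:E = \int[mu]_(t in `]a, b]%classic) tdens P t.
  move=> ab; have := gweight_itv_balance Poo false ab.
  rewrite (integral_tweight Poo b (measurable_itv _)) tilt_itvNyc.
  rewrite (integral_tweight Poo a (measurable_itv _)) tilt_itvNyc.
  have := integral_tdens_itv_fin_num ab.
  set F := \int[mu]_(t in _) _ ; set M := \int[P]_(x in _) _.
  case: F => // rF _.
  have M0 : 0 <= M by apply: integral_ge0 => x _; rewrite lee_fin gweight_ge0.
  case: M M0 => [rM||//] _; last by rewrite -!EFinM -!EFinD gt0_muley ?lte_fin// addye.
  rewrite -!EFinM -!EFinD => -[].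
  by move: (It a) (It b) => u v h; congr (_%:E); lra.
apply: eq_integral_itvoc => //.
- by apply/measurable_EFinP; exact: measurable_gweight.
- exact: measurable_tdens.
- by move=> x; rewrite lee_fin gweight_ge0.
- exact: tdens_ge0.
- move=> a b; have [ab|ba] := ltP a b.
    by rewrite itvE// -ge0_fin_numE ?integral_tdens_itv_fin_num// integral_ge0// => t _; exact: tdens_ge0.
  by rewrite set_itv_ge ?bnd_simp -?leNgt// integral_set0.
Qed.

End tilted_density_equation.

Section choquet_deny.
Context {R : realType}.
Local Notation mu := (@lebesgue_measure R).
Local Notation mR := (measurableTypeR R).
Context (f : mR -> R) (mf : measurable_fun setT f) (f0 : forall x, 0 <= f x).
Context (kf : forall t, (\int[mu]_x (kern 1 (x - t) * f x)%:E = (f t)%:E)%E).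

Let g x : R := f x / (1 + f x).
Let gap t x : R := (f x - f t) ^+ 2 / ((1 + f x) * (1 + f t) ^+ 2).
Let defect t : \bar R := (\int[mu]_x (kern 1 (x - t) * gap t x)%:E)%E.

Let f1 x : 0 < 1 + f x. Proof. by rewrite ltr_wpDr. Qed.

Let g_ge0 x : 0 <= g x. Proof. by rewrite divr_ge0// ltW. Qed.

Let g_le1 x : g x <= 1.
Proof. by rewrite ler_pdivrMr// mul1r lerDr. Qed.

Let gap_ge0 t x : 0 <= gap t x.
Proof. by rewrite divr_ge0 ?sqr_ge0// mulr_ge0 ?sqr_ge0// ltW. Qed.

Let measurable_invD : measurable_fun [set: mR] (fun x => (1 + f x)^-1).
Proof.
rewrite (_ : (fun x => _) = (fun x => expR (- ln (1 + f x)))).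
  apply: measurableT_comp => //; apply: measurableT_comp => //.
  by apply: measurableT_comp; [exact: measurable_ln|exact: measurable_funD].
by apply/funext => x; rewrite expRN lnK// posrE.
Qed.

Let measurable_g : measurable_fun [set: mR] g.
Proof. exact: measurable_funM. Qed.

Let measurable_kern_sub t : measurable_fun [set: mR] (fun x : mR => kern 1 (x - t)).
Proof.
apply: measurableT_comp; first exact: measurable_kern.
exact: measurable_funB.
Qed.

Let measurable_kern2 : measurable_fun [set: mR * mR] (fun p => kern 1 (p.1 - p.2)).
Proof.
apply: measurableT_comp; first exact: measurable_kern.
exact: measurable_funB.
Qed.

Let measurable_kern_gap :
  measurable_fun [set: mR * mR] (fun p => kern 1 (p.1 - p.2) * gap p.2 p.1).
Proof.
apply: measurable_funM; first exact: measurable_kern2.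
rewrite (_ : (fun p : mR * mR => gap p.2 p.1) =
    fun p => (f p.1 - f p.2) ^+ 2 * ((1 + f p.1)^-1 * ((1 + f p.2)^-1) ^+ 2)).
  have m1 : measurable_fun [set: mR * mR] (fun p => f p.1) by exact: measurableT_comp.
  have m2 : measurable_fun [set: mR * mR] (fun p => f p.2) by exact: measurableT_comp.
  have m3 : measurable_fun [set: mR * mR] (fun p => (1 + f p.1)^-1).
    exact: (measurableT_comp measurable_invD).
  have m4 : measurable_fun [set: mR * mR] (fun p => (1 + f p.2)^-1).
    exact: (measurableT_comp measurable_invD).
  apply: measurable_funM; first by apply: measurable_funX; exact: measurable_funB.
  by apply: measurable_funM => //; exact: measurable_funX.
by apply/funext => p; rewrite /gap invfM exprVn.
Qed.

Let defect_ge0 t : (0 <= defect t)%E.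
Proof. by apply: integral_ge0 => x _; rewrite lee_fin mulr_ge0 ?kern_ge0. Qed.

Let measurable_defect : measurable_fun [set: mR] defect.
Proof.
apply: (@measurable_fun_fubini_tonelli_G _ _ _ _ _ mu
  (fun p : mR * mR => (kern 1 (p.1 - p.2) * gap p.2 p.1)%:E)).
- exact/measurable_EFinP.
- by move=> p; rewrite lee_fin mulr_ge0 ?kern_ge0.
Qed.

(* [y / (1 + y)] lies below its tangent line at [f t]; [gap] is the exact
   difference, so the averaging kernel misses [g t] by exactly [defect t]. *)
Let kern_g t :
  (\int[mu]_x (kern 1 (x - t) * g x)%:E + defect t = (g t)%:E)%E.
Proof.
have mgap : measurable_fun [set: mR] (fun x : mR => kern 1 (x - t) * gap t x).
  exact: (measurableT_comp measurable_kern_gap (pair2_measurable t)).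
have mkg : measurable_fun [set: mR] (fun x : mR => kern 1 (x - t) * g x).
  exact: measurable_funM.
have mkf : measurable_fun [set: mR] (fun x : mR => kern 1 (x - t) * f x).
  exact: measurable_funM.
pose c := ((1 + f t) ^+ 2)^-1.
have c0 : 0 <= c by rewrite invr_ge0 sqr_ge0.
have k0 x : 0 <= kern 1 (x - t) by exact: kern_ge0.
have kc (d : R) : 0 <= d -> (\int[mu]_x (kern 1 (x - t) * d)%:E = d%:E)%E.
  move=> d0; under eq_integral do rewrite EFinM.
  rewrite ge0_integralZr//; last 2 first.
  - exact/measurable_EFinP.
  - by move=> x _; rewrite lee_fin.
  under eq_integral do rewrite -kernN opprB.
  by rewrite integral_kern_sub mul1e.
have e1 : (\int[mu]_x (kern 1 (x - t) * g x)%:E + defect t + (f t * c)%:E =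
    (g t)%:E + (f t * c)%:E)%E.
  have ftc : 0 <= f t * c by rewrite mulr_ge0.
  rewrite -{1}(kc _ ftc) -(kc _ (g_ge0 t)).
  have -> : (f t * c)%:E = (\int[mu]_x (c * (kern 1 (x - t) * f x))%:E)%E.
    rewrite ge0_integralZl_EFinM//; last by move=> x; rewrite mulr_ge0.
    by rewrite kf -EFinM mulrC.
  have mkc d : measurable_fun [set: mR] (fun x : mR => kern 1 (x - t) * d).
    exact: measurable_funM.
  have kgap0 x : 0 <= kern 1 (x - t) * gap t x by rewrite mulr_ge0.
  have kg0 x : 0 <= kern 1 (x - t) * g x by rewrite mulr_ge0.
  have kf0 x : 0 <= c * (kern 1 (x - t) * f x) by rewrite !mulr_ge0.
  have kd0 d x : 0 <= d -> 0 <= kern 1 (x - t) * d by move=> d0; rewrite mulr_ge0.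
  have mcf : measurable_fun [set: mR] (fun x : mR => c * (kern 1 (x - t) * f x)).
    exact: measurable_funM.
  have kgg0 x : 0 <= kern 1 (x - t) * g x + kern 1 (x - t) * gap t x.
    by rewrite addr_ge0.
  rewrite /defect -(ge0_integralD_EFin mu mkg mgap kg0 kgap0).
  rewrite -(ge0_integralD_EFin mu (measurable_funD mkg mgap) (mkc (f t * c)) kgg0 (fun x => kd0 _ x ftc)).
  rewrite -(ge0_integralD_EFin mu (mkc (g t)) mcf (fun x => kd0 _ x (g_ge0 t)) kf0).
  apply: eq_integral => x _; congr (_%:E).
  by rewrite /g /gap /c /=; field; rewrite !gt_eqF.
by have := congr1 (fun z => z - (f t * c)%:E)%E e1; rewrite !addeK.
Qed.

Let defect_normal_pdf s : s != 0 ->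
  (\int[mu]_t ((normal_pdf 0 s t)%:E * defect t) <= ((s ^+ 2)^-1)%:E)%E.
Proof.
move=> s0; have s2 : 0 < s ^+ 2 by rewrite exprn_even_gt0.
set L := normal_pdf 0 s.
have L0 x : 0 <= L x by exact: normal_pdf_ge0.
have mL : measurable_fun [set: mR] L by exact: measurable_normal_pdf.
have mLE : measurable_fun [set: mR] (EFin \o L) by exact/measurable_EFinP.
pose c := 1 + (s ^+ 2)^-1.
have c0 : 0 < c by rewrite addr_gt0// invr_gt0.
have kL x : (((c^-1 * L x)%:E <= \int[mu]_t (kern 1 (x - t) * L t)%:E))%E.
  rewrite /L normal_pdfE// mulrCA EFinM.
  have := kern_normal_fun_ge x s0.
  have pk := normal_peak_ge0 s.
  rewrite -/c => h; apply: (le_trans (lee_wpmul2l _ h)); first by rewrite lee_fin.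
  rewrite -ge0_integralZl_EFinM//; last 2 first.
  - apply: measurable_funM; last exact: measurable_normal_fun.
    under eq_fun do rewrite -kernN opprB; exact: measurable_kern_sub.
  - by move=> t; rewrite mulr_ge0 ?kern_ge0// expR_ge0.
  rewrite le_eqVlt; apply/orP; left; apply/eqP; apply: eq_integral => t _.
  by rewrite mulrCA.
pose A := (\int[mu]_t (L t * g t)%:E)%E.
pose K t := (\int[mu]_x (kern 1 (x - t) * g x)%:E)%E.
pose F (p : mR * mR) := (L p.2 * (kern 1 (p.1 - p.2) * g p.1))%:E.
have mF : measurable_fun setT F.
  apply/measurable_EFinP; apply: measurable_funM; first exact: measurableT_comp.
  by apply: measurable_funM => //; exact: measurableT_comp.
have F0 p : (0 <= F p)%E by rewrite lee_fin mulr_ge0// mulr_ge0 ?kern_ge0.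
have K0 t : (0 <= K t)%E.
  by apply: integral_ge0 => x _; rewrite lee_fin mulr_ge0 ?kern_ge0.
have LK t : ((L t)%:E * K t = \int[mu]_x F (x, t))%E.
  rewrite /K -ge0_integralZl_EFinM//; first exact: measurable_funM.
  by move=> x; rewrite mulr_ge0 ?kern_ge0.
have mK : measurable_fun [set: mR] (fun t => (L t)%:E * K t)%E.
  under eq_fun do rewrite LK.
  exact: (@measurable_fun_fubini_tonelli_G _ _ _ _ _ mu F).
have Asplit : A = (\int[mu]_t ((L t)%:E * K t) + \int[mu]_t ((L t)%:E * defect t))%E.
  rewrite -ge0_integralD//.
  - apply: eq_integral => t _; rewrite EFinM -kern_g ge0_muleDr//; exact: K0.
  - by move=> t _; rewrite mule_ge0// lee_fin.
  - by move=> t _; rewrite mule_ge0// lee_fin.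
  - exact: emeasurable_funM.
have AleB : ((c^-1)%:E * A <= \int[mu]_t ((L t)%:E * K t))%E.
  under [leRHS]eq_integral do rewrite LK.
  rewrite -(fubini_tonelli F)//.
  rewrite /A -ge0_integralZl_EFinM ?invr_ge0 ?(ltW c0)//; last 2 first.
  - exact: measurable_funM.
  - by move=> x; rewrite mulr_ge0.
  apply: ge0_le_integral => //.
  - move=> x _; rewrite lee_fin mulr_ge0 ?invr_ge0 ?(ltW c0)//.
    by rewrite mulr_ge0 ?L0 ?g_ge0.
  - by apply/measurable_EFinP; apply: measurable_funM => //; exact: measurable_funM.
  - exact: measurable_fun_fubini_tonelli_F.
  move=> x _; have gx0 : (0 <= (g x)%:E)%E by rewrite lee_fin.
  rewrite mulrA EFinM muleC; apply: (le_trans (lee_wpmul2l gx0 (kL x))).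
  rewrite -ge0_integralZl_EFinM//; last by move=> t; rewrite mulr_ge0 ?kern_ge0.
    rewrite le_eqVlt; apply/orP; left; apply/eqP; apply: eq_integral => t _.
    by rewrite /F /=; congr (_%:E); ring.
  apply: measurable_funM => //.
  exact: (measurableT_comp measurable_kern2 (pair1_measurable x)).
have A1 : (A <= 1)%E.
  rewrite -(integral_normal_pdf 0 s); apply: ge0_le_integral => //.
  - by move=> x _; rewrite lee_fin mulr_ge0.
  - by apply/measurable_EFinP; exact: measurable_funM.
  - by move=> x _; rewrite lee_fin ler_piMr.
have A0 : (0 <= A)%E by apply: integral_ge0 => x _; rewrite lee_fin mulr_ge0.
have H0 : (0 <= \int[mu]_t ((L t)%:E * defect t))%E.
  by apply: integral_ge0 => x _; rewrite mule_ge0// lee_fin.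
have B0 : (0 <= \int[mu]_t ((L t)%:E * K t))%E.
  by apply: integral_ge0 => x _; rewrite mule_ge0// lee_fin.
move: Asplit AleB A1 A0 H0 B0.
set H := (\int[mu]_t ((L t)%:E * defect t))%E.
set B := (\int[mu]_t ((L t)%:E * K t))%E.
case: A => // a; case: H => // [h|]; case: B => // b.
rewrite -EFinM !lee_fin => -[->] AB A1 A0 H0 B0.
have cE : c^-1 = 1 - (s ^+ 2)^-1 * c^-1.
  by rewrite /c; field; rewrite s0/= gt_eqF// addr_gt0.
have v0 : 0 <= (s ^+ 2)^-1 by rewrite invr_ge0 ltW.
have c1 : c^-1 <= 1 by rewrite invf_le1// lerDl.
have ci : 0 <= c^-1 by rewrite invr_ge0 ltW.
have := ler_wpM2l (mulr_ge0 v0 ci) A1.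
have := ler_wpM2l v0 c1.
move: AB; rewrite cE; nra.
Qed.

Let normal_pdf1_le (s x : R) : 1 <= s -> normal_pdf 0 1 x <= s * normal_pdf 0 s x.
Proof.
move=> s1; have s0 : 0 < s by exact: lt_le_trans s1.
rewrite !normal_pdfE ?oner_eq0 ?gt_eqF// mulrA.
have -> : s * normal_peak s = normal_peak 1.
  rewrite /normal_peak -!mulrnAr (sqrtrM _ (sqr_ge0 s)) sqrtr_sqr gtr0_norm// expr1n mul1r.
  by rewrite invfM mulrA divff ?mul1r// gt_eqF.
rewrite ler_wpM2l ?normal_peak_ge0// ler_expR.
rewrite !mulNr lerN2 ler_wpM2l ?sqr_ge0// lef_pV2 ?posrE ?mulrn_wgt0// ?exprn_gt0//.
by rewrite lerMn2r/= expr1n exprn_ege1.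
Qed.

Let defect_eq0 : (\int[mu]_t ((normal_pdf 0 1 t)%:E * defect t) = 0)%E.
Proof.
have mpd s : measurable_fun [set: mR] (fun t => (normal_pdf 0 s t)%:E * defect t)%E.
  by apply: emeasurable_funM => //; apply/measurable_EFinP; exact: measurable_normal_pdf.
have pd0 s t : (0 <= (normal_pdf 0 s t)%:E * defect t)%E.
  by rewrite mule_ge0// lee_fin normal_pdf_ge0.
apply/eqP; rewrite eq_le; apply/andP; split; last exact: integral_ge0.
apply/lee_addgt0Pr => e e0; rewrite add0e.
pose s : R := (Num.truncn e^-1).+1%:R.
have s1 : 1 <= s by rewrite ler1n.
have s0 : 0 < s by exact: lt_le_trans s1.
apply: (@le_trans _ _ (s%:E * \int[mu]_t ((normal_pdf 0 s t)%:E * defect t))%E).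
  rewrite -ge0_integralZl_EFin ?(ltW s0)//.
  apply: ge0_le_integral => //.
  - exact: measurable_funeM.
  - by move=> t _; rewrite muleA -EFinM lee_wpmul2r// lee_fin normal_pdf1_le.
have h := @defect_normal_pdf s (lt0r_neq0 s0).
have s0E : (0 <= s%:E)%E by rewrite lee_fin ltW.
apply: (le_trans (lee_wpmul2l s0E h)).
rewrite -EFinM lee_fin expr2 invfM mulrA divff ?gt_eqF// mul1r.
by rewrite -[leRHS]invrK lef_pV2 ?posrE ?invr_gt0// ltW// /s Num.Theory.truncnS_gt.
Qed.

Lemma kern_invariant_ae_cst : exists t, {ae mu, forall x, f x = f t}.
Proof.
have mpd : measurable_fun [set: mR] (fun t => (normal_pdf 0 1 t)%:E * defect t)%E.
  apply: emeasurable_funM => //; apply/measurable_EFinP; exact: measurable_normal_pdf.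
have pd0 t : (0 <= (normal_pdf 0 1 t)%:E * defect t)%E.
  by rewrite mule_ge0// lee_fin normal_pdf_ge0.
have [t ht] : exists t, defect t = 0%E.
  have h0 : (\int[mu]_t `|(normal_pdf 0 1 t)%:E * defect t| = 0)%E.
    by rewrite -[RHS]defect_eq0; apply: eq_integral => t _; rewrite gee0_abs.
  have [N [mN N0 sN]] := (@ae_eq_integral_abs _ _ _ mu setT measurableT _ mpd).1 h0.
  apply: contrapT => /forallNP nh.
  have NT : N = setT.
    rewrite -subTset => x _; apply: sN => /= /(_ Logic.I) /eqP.
    rewrite mule_eq0 eqe normal_pdfE ?oner_eq0// gt_eqF ?mulr_gt0 ?expR_gt0 ?normal_peak_gt0 ?oner_eq0//=.
    by move/eqP; exact: nh.
  have : mu (`]-oo, +oo[%classic : set R) = 0%E by rewrite set_itvNyy -NT.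
  by rewrite lebesgue_measure_itv.
exists t.
have mk : measurable_fun [set: mR] (fun x => (kern 1 (x - t) * gap t x)%:E).
  apply/measurable_EFinP; exact: (measurableT_comp measurable_kern_gap (pair2_measurable t)).
have h0 : (\int[mu]_x `|(kern 1 (x - t) * gap t x)%:E| = 0)%E.
  rewrite -[RHS]ht; apply: eq_integral => x _.
  by rewrite gee0_abs// lee_fin mulr_ge0 ?kern_ge0.
have := (@ae_eq_integral_abs _ _ _ mu setT measurableT _ mk).1 h0.
apply: filterS => x /(_ Logic.I) [] /eqP.
have [->//|xt] := eqVneq x t.
rewrite mulf_eq0 gt_eqF/=; last first.
  by rewrite /kern divr_gt0// mulr_gt0 ?expR_gt0// normr_gt0 subr_eq0.
have dp : 0 < ((1 + f x) * (1 + f t) ^+ 2)^-1 by rewrite invr_gt0 mulr_gt0// exprn_gt0.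
by rewrite /gap mulf_eq0 (gt_eqF dp) orbF expf_eq0/= subr_eq0 => /eqP.
Qed.

End choquet_deny.

Section normal_half.
Context {R : realType}.
Local Notation mu := (@lebesgue_measure R).
Local Notation mR := (measurableTypeR R).
Local Open Scope ereal_scope.

Lemma normal_prob_itvNyc (m s : R) :
  normal_prob m s `]-oo, m]%classic = normal_prob m s `]-oo, m[%classic.
Proof.
rewrite /normal_prob; apply/esym/integral_itv_bndo_bndc.
by apply: measurable_funTS; apply/measurable_EFinP; exact: measurable_normal_pdf.
Qed.

Lemma normal_prob_itvNyo (m s : R) : s != 0%R ->
  normal_prob m s `]-oo, m[%classic = (2^-1)%:E.
Proof.
move=> s0; have mpdf := measurable_normal_pdf m s.
have half : normal_prob m s `]-oo, m[%classic = normal_prob m s `]m, +oo[%classic.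
  rewrite /normal_prob (integral_indicM mu _ `]-oo, m[%classic) (integral_indicM mu _ `]m, +oo[%classic).
  rewrite (@ge0_integral_reflect _ (m + m)
    (fun x => (normal_pdf m s x * \1_(`]-oo, m[%classic) x)%:E)).
  - apply: eq_integral => x _; rewrite !normal_pdfE// !indicE !mem_setE !in_itv/=.
    have -> : (m + m - x < m)%R = (m < x)%R by apply/idP/idP; lra.
    rewrite andbT; congr (_ * _ * _)%:E; congr expR; congr (_ / _)%R; ring.
  - apply/measurable_EFinP; apply: measurable_funM => //; exact: measurable_indic.
  - by move=> x; rewrite lee_fin mulr_ge0 ?normal_pdf_ge0// indicE.
have total : normal_prob m s `]-oo, m]%classic + normal_prob m s `]m, +oo[%classic = 1.
  rewrite -measureU//.
  - rewrite (_ : _ `|` _ = setT); first exact: probability_setT.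
    by rewrite -subTset => x _ /=; rewrite !in_itv/= andbT; case: (leP x m); [left|right].
  - by apply/seteqP; split => x //= []; rewrite !in_itv/=; lra.
move: total; rewrite normal_prob_itvNyc -half.
have : normal_prob m s `]-oo, m[%classic \is a fin_num.
  by rewrite fin_num_measure.
case: (normal_prob m s _) => // r _; rewrite -EFinD => -[rr].
by congr (_%:E); lra.
Qed.

End normal_half.

Section characterization.
Context {R : realType} (P : probability (measurableTypeR R) R).
Local Notation mu := (@lebesgue_measure R).
Local Notation mR := (measurableTypeR R).
Local Open Scope ereal_scope.

Lemma expRM_normal_pdf (t x : R) :
  (expR (t * x) * normal_pdf 0 1 x = expR (t ^+ 2 / 2) * normal_pdf t 1 x)%R.
Proof.
rewrite !normal_pdfE ?oner_eq0// mulrCA [RHS]mulrCA; congr (_ * _)%R.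
by rewrite -!expRD; congr expR; field.
Qed.

Lemma normal_tilt_median_class :
  (forall A : set mR, measurable A -> P A = normal_prob 0%R 1%R A) ->
  tilt_median_class P.
Proof.
move=> PN.
have PE (H : mR -> R) : measurable_fun setT H -> (forall x, 0 <= H x)%R ->
    \int[P]_x (H x)%:E = \int[mu]_x (H x * normal_pdf 0 1 x)%:E.
  move=> mH H0.
  rewrite -(@eq_integral_weighted _ P mu (cst 1%R) (normal_pdf 0 1) H)//.
  - by apply: eq_integral => x _; rewrite mulr1.
  - exact: measurable_normal_pdf.
  - by move=> x; exact: normal_pdf_ge0.
  - move=> A mA; transitivity (1 * P A); first exact: (integral_cst P mA 1).
    by rewrite mul1e PN.
have me t : measurable_fun [set: mR] (fun x : mR => expR (t * x)).
  by apply/measurable_EFinP; exact: measurable_expRM.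
have mpdf t : measurable_fun [set: mR] (normal_pdf t 1 : mR -> R).
  exact: measurable_normal_pdf.
have LE t : laplace P t = (expR (t ^+ 2 / 2))%:E.
  rewrite /laplace PE//.
  under eq_integral do rewrite expRM_normal_pdf.
  rewrite ge0_integralZl_EFinM ?expR_ge0//.
    by rewrite integral_normal_pdf mule1.
  by move=> x; exact: normal_pdf_ge0.
have TE t (D : set mR) : measurable D -> tilt P t D = normal_prob t 1%R D.
  move=> mD; have mI : measurable_fun [set: mR] (\1_D : mR -> R).
    exact: measurable_indic.
  rewrite /tilt LE (integral_indicM P _ D) PE; last 2 first.
  - by apply: measurable_funM => //; exact: measurable_funM.
  - by move=> x; rewrite !mulr_ge0 ?invr_ge0 ?expR_ge0// indicE.
  rewrite /normal_prob (integral_indicM mu _ D); apply: eq_integral => x _ /=.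
  congr (_%:E).
  transitivity (expR (t * x) * normal_pdf 0 1 x * \1_D x / expR (t ^+ 2 / 2))%R; first by ring.
  by rewrite expRM_normal_pdf; field; rewrite gt_eqF ?expR_gt0.
split=> t; first by rewrite LE ltry.
by rewrite !TE// normal_prob_itvNyc normal_prob_itvNyo ?oner_eq0.
Qed.

Lemma tilt_median_class_normal : tilt_median_class P ->
  forall A : set mR, measurable A -> P A = normal_prob 0%R 1%R A.
Proof.
move=> PM; have fnum t := tdens_fin_num PM.1 t.
pose f (x : mR) : R := fine (tdens P x).
have fE x : (f x)%:E = tdens P x by rewrite fineK.
have mf : measurable_fun setT f.
  by apply: measurableT_comp => //; exact: measurable_tdens.
have f0 x : (0 <= f x)%R by rewrite fine_ge0// tdens_ge0.
have PE (H : mR -> R) : measurable_fun setT H -> (forall x, 0 <= H x)%R ->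
    \int[P]_x (H x * gweight x)%:E = \int[mu]_x (H x * f x)%:E.
  move=> mH H0; apply: eq_integral_weighted => //.
  - exact: measurable_gweight.
  - by move=> x; exact: gweight_ge0.
  - move=> A mA; rewrite (integral_gweightE PM)//.
    by apply: eq_integral => x _; rewrite fE.
have [t tE] : exists t, {ae mu, forall x, f x = f t}.
  apply: kern_invariant_ae_cst => // t.
  rewrite fE -PE//.
  - apply: measurableT_comp; first exact: measurable_kern.
    exact: measurable_funB.
  - by move=> x; exact: kern_ge0.
pose C := (f t / normal_peak 1)%R.
have pk0 : (0 < normal_peak (1 : R))%R by rewrite normal_peak_gt0// oner_eq0.
have C0 : (0 <= C)%R by rewrite divr_ge0// ltW.
have PC (A : set mR) : measurable A -> P A = C%:E * normal_prob 0%R 1%R A.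
  move=> mA; have mI : measurable_fun [set: mR] (\1_A : mR -> R).
    exact: measurable_indic.
  pose H (x : mR) : R := (\1_A x * expR (- (1 * x ^+ 2 / 2)))%R.
  have mH : measurable_fun setT H.
    apply: measurable_funM => //; apply: continuous_measurable_fun.
    exact: continuous_expR_quad.
  have H0 x : (0 <= H x)%R by rewrite mulr_ge0 ?expR_ge0// indicE.
  transitivity (\int[P]_x (H x * gweight x)%:E).
    rewrite -[A in LHS]setIT -integral_indic//; apply: eq_integral => x _.
    have e : (expR (- (1 * x ^+ 2 / 2)) * expR (x ^+ 2 / 2) = 1)%R.
      by rewrite -expRD mul1r addNr expR0.
    by rewrite -[X in X%:E = _]mulr1 -e /H /gweight; congr (_%:E); ring.
  rewrite PE// /normal_prob (integral_indicM mu _ A) -ge0_integralZl_EFinM//; last 2 first.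
  - by apply: measurable_funM => //; exact: measurable_normal_pdf.
  - by move=> x; rewrite mulr_ge0 ?normal_pdf_ge0// indicE.
  transitivity (\int[mu]_x (H x * f t)%:E).
    apply: ge0_ae_eq_integral => //.
    - by apply/measurable_EFinP; exact: (measurable_funM mH mf).
    - by apply/measurable_EFinP; exact: (measurable_funM mH (measurable_cst (f t))).
    - by move=> x _; rewrite lee_fin mulr_ge0.
    - by move=> x _; rewrite lee_fin mulr_ge0.
    - by apply: filterS tE => x -> _.
  apply: eq_integral => x _; rewrite normal_pdfE ?oner_eq0// /H /C /normal_fun subr0.
  rewrite (_ : - x ^+ 2 / (1 ^+ 2 *+ 2) = - (1 * x ^+ 2 / 2))%R; last by field.
  by congr (_%:E); field; rewrite gt_eqF.
have := PC setT measurableT; rewrite !probability_setT mule1 => -[C1].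
by move=> A mA; rewrite PC// -C1 mul1e.
Qed.

End characterization.

(* MathComp(-Analysis) world.  Library measures are functions on all sets,
   constrained only on measurable ones, so equality of the measures P and
   N(0,1) is equality on every Borel set. *)
Theorem theorem1 (R : realType) (P : probability (measurableTypeR R) R) :
  tilt_median_class P <->
  (forall A : set (measurableTypeR R), measurable A ->
     P A = normal_prob (0 : R) (1 : R) A).
Proof.
split; [exact: tilt_median_class_normal|exact: normal_tilt_median_class].
Qed.
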